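(* If a Hausdorff topological semigroup $S$ contains the semigroup $\mathbf{ID}_{\infty}$ as a dense discrete subsemigroup, then the square $S\times S$ is not a feebly compact space.
   Context: A partial cofinite isometry of the set of integers $\mathbb{Z}$ is a partial map $\alpha\colon\mathbb{Z}\rightharpoonup\mathbb{Z}$ such that $\mathbb{Z}\setminus\operatorname{dom}\alpha$ and $\mathbb{Z}\setminus\operatorname{ran}\alpha$ are finite and $|(x)\alpha-(y)\alpha|=|x-y|$ for all $x,y\in\operatorname{dom}\alpha$. $\mathbf{ID}_{\infty}$ is the semigroup (an inverse monoid) of all partial cofinite isometries of $\mathbb{Z}$ under composition of partial maps (maps written on the right). A topological semigroup is a topological space with a jointly continuous semigroup operation. ''Dense discrete subsemigroup'' means that (an isomorphic copy of) $\mathbf{ID}_{\infty}$ is a subsemigroup of $S$ that is dense in $S$ and whose subspace topology is discrete. A space $X$ is feebly compact if every locally finite family of nonempty open subsets of $X$ is finite. *)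

(* Defs.v *)
From HB Require Import structures.
From mathcomp Require Import all_boot all_order all_algebra.
From mathcomp Require Import all_classical all_analysis.

Set Implicit Arguments.
Unset Strict Implicit.
Unset Printing Implicit Defensive.

Import Order.TTheory GRing.Theory Num.Theory.

Local Open Scope classical_set_scope.
Local Open Scope ring_scope.

Definition pdom (f : int -> option int) : set int :=
  [set x | exists y, f x = Some y].

Definition pran (f : int -> option int) : set int :=
  [set y | exists x, f x = Some y].

Definition pisometry (f : int -> option int) : Prop :=
  forall x y x' y', f x = Some x' -> f y = Some y' -> `|x' - y'| = `|x - y|.

Record ID_infty := MkID {
  ID_fun :> int -> option int;
  cofinite_pdom : cofinite_set (pdom ID_fun);
  cofinite_pran : cofinite_set (pran ID_fun);
  ID_pisometry : pisometry ID_fun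
}.

(* Maps are written on the right: [f] is applied first. *)
Definition pcomp (f g : int -> option int) : int -> option int :=
  fun x => obind g (f x).

Lemma pisometry_inj f x y z :
  pisometry f -> f x = Some z -> f y = Some z -> x = y.
Proof.
move=> fi fx fy; have := fi _ _ _ _ fx fy.
by rewrite subrr normr0 => /esym/eqP; rewrite normr_eq0 subr_eq0 => /eqP.
Qed.

Lemma pcomp_isometry f g :
  pisometry f -> pisometry g -> pisometry (pcomp f g).
Proof.
rewrite /pcomp => fi gi x y x' y'.
case fx: (f x) => [u|//] /= gu; case fy: (f y) => [v|//] /= gv.
by rewrite (gi _ _ _ _ gu gv) (fi _ _ _ _ fx fy).
Qed.

Lemma cofinite_pdom_comp f g : pisometry f ->
  cofinite_set (pdom f) -> cofinite_set (pdom g) ->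
  cofinite_set (pdom (pcomp f g)).
Proof.
move=> fi fD gD.
apply: (@sub_finite_set _ _ (~` pdom f `|` f @^-1` (Some @` ~` pdom g))).
  rewrite /pcomp => x /= nx; case fx: (f x) => [u|]; last first.
    by left; case=> y; rewrite fx.
  right; exists u => // -[v gu]; apply: nx.
  by exists v; rewrite fx.
rewrite finite_setU; split=> //; apply: finite_preimage; last exact: finite_image.
move=> x y; rewrite !inE => -[u _ xu] [v _ yv] xy.
by apply: (@pisometry_inj f x y u) => //; rewrite -xy.
Qed.

Lemma cofinite_pran_comp f g :
  cofinite_set (pran f) -> cofinite_set (pran g) ->
  cofinite_set (pran (pcomp f g)).
Proof.
move=> fR gR.
pose h u := if g u is Some z then z else 0.
apply: (@sub_finite_set _ _ (~` pran g `|` h @` ~` pran f)); last first.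
  by rewrite finite_setU; split=> //; exact: finite_image.
move=> z /= nz; have [[u gu]|] := pselect (pran g z); last by left.
right; exists u; last by rewrite /h gu.
by case=> x fx; apply: nz; exists x; rewrite /pcomp fx.
Qed.

Definition ID_mul (a b : ID_infty) : ID_infty :=
  MkID (cofinite_pdom_comp (@ID_pisometry a)
          (cofinite_pdom a) (cofinite_pdom b))
       (cofinite_pran_comp (cofinite_pran a) (cofinite_pran b))
       (pcomp_isometry (@ID_pisometry a) (@ID_pisometry b)).

Lemma ID_eq (a b : ID_infty) : a =1 b -> a = b.
Proof.
case: a => f fD fR fi; case: b => g gD gR gi /= /funext fg.
move: fD fR fi; rewrite fg => fD fR fi.
by congr MkID; exact: Prop_irrelevance.
Qed.

Lemma ID_mulA : associative ID_mul.
Proof.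
by move=> a b c; apply: ID_eq => x; rewrite /= /pcomp /=; case: (a x).
Qed.

HB.instance Definition _ := gen_eqMixin ID_infty.
HB.instance Definition _ := gen_choiceMixin ID_infty.
HB.instance Definition _ := isSemigroup.Build ID_infty ID_mulA.

HB.mixin Record isTopologicalSemigroup S of Topological S & Semigroup S := {
  mulg_continuous : continuous (fun p : S * S => (p.1 * p.2)%g)
}.

#[short(type="topologicalSemigroupType")]
HB.structure Definition TopologicalSemigroup :=
  {S of Topological S & Semigroup S & isTopologicalSemigroup S}.

(* [set_type A] carries the subspace topology. *)
Definition discrete_subspace (X : topologicalType) (A : set X) : Prop :=
  forall B : set (set_type A), open B.

Definition locally_finite (X : topologicalType) (F : set (set X)) : Prop :=
  forall x : X, exists2 V, nbhs x V &
    finite_set [set U | F U /\ U `&` V !=set0].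

Definition feebly_compact (X : topologicalType) : Prop :=
  forall F : set (set X),
    (forall U, F U -> open U /\ U !=set0) -> locally_finite F -> finite_set F.

(* Main.v *)
Require Import Defs.
From HB Require Import structures.
From mathcomp Require Import all_boot all_order all_algebra.
From mathcomp Require Import all_classical all_analysis.

Local Open Scope classical_set_scope.

(** The reason is that the semigroup of partial cofinite isometries has
    infinitely many units, for instance the translations [t_n : z |-> z + n].
    A dense discrete subspace of a T1 space consists of isolated points
    ([dense_discrete_open1]), so the [t_n] and the identity map [c] are isolated
    in [S], and the singletons [{(t_n, t_-n)}] are open in [S * S].

    These infinitely many singletons form a locally finite family
    ([crossed_factorizations_not_feebly_compact]).  Indeed the set [T] of all
    [(u, v)] with [u * v = c] is clopen and contains them all.  A point outside
    [T] has the complement of [T] as a neighbourhood.  A point of [T] has a box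
    [U `*` V] inside [T], and this box contains at most one of the pairs: if it
    contains [(t_m, t_-m)] and [(t_n, t_-n)], it also contains the crossed pair
    [(t_m, t_-n)], whose product is [c] only if [m = n]. *)

(** Some open [W] meets [A] in [a] alone; were [W] larger than [a], the open set
    obtained by removing the closed point [a] from [W] would miss the dense
    set [A]. *)
Lemma dense_discrete_open1 (X : topologicalType) (A : set X) (a : X) :
  accessible_space X -> dense A -> discrete_subspace A -> A a ->
  open [set a].
Proof.
move=> T1 dA discA Aa; pose sa : set_type A := exist _ a (mem_set Aa).
have [W oW WA] := discA [set sa].
have Wa : W a by rewrite -[W a]/((set_val @^-1` W) sa) WA.
suff <- : W = [set a] by [].
apply/seteqP; split=> [w Ww|_ ->//]; apply: contrapT => /= wa.
have oWa : open (W `&` ~` [set a]).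
  by apply: openI => //; rewrite openC; exact: accessible_closed_set1.
have [|b [[Wb ba] Ab]] := dA (W `&` ~` [set a]) _ oWa; first by exists w.
apply: ba; have : (set_val @^-1` W) (exist _ b (mem_set Ab)) by [].
by rewrite WA => /(congr1 set_val).
Qed.

(** The singletons of the pairs [(x n, y n)] are a locally finite family of open
    sets: a box on which the product is constantly [c] cannot contain two of
    these pairs, because it would contain the crossed pairs too, while away from
    [c] the product avoids the closed point [c] on a whole neighbourhood. *)
Lemma crossed_factorizations_not_feebly_compact
    (S : topologicalSemigroupType) (c : S) (x y : nat -> S) :
  accessible_space S -> open [set c] ->
  (forall n, open [set x n]) -> (forall n, open [set y n]) ->
  (forall m n, (x m * y n)%g = c <-> m = n) ->
  ~ feebly_compact (S * S)%type.
Proof.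
move=> T1 oc ox oy xyc fc.
pose f n : set (S * S) := [set (x n, y n)].
have f_inj : injective f.
  move=> m n fmn; apply/xyc.
  have : f n (x m, y m) by rewrite -fmn.
  by case=> -> _; apply/xyc.
suff /(finite_preimage (f := f)) : finite_set (range f).
  rewrite (_ : f @^-1` range f = setT); last first.
    by apply/seteqP; split=> // n _; exists n.
  move=> fin; apply: infinite_nat; apply: fin.
  by move=> m n _ _; exact: f_inj.
apply: fc => [_ [n _ <-]|[u v]].
  split; last by exists (x n, y n).
  rewrite openE => _ ->; exists ([set x n], [set y n]).
    by split; apply: open_nbhs_nbhs; split=> /=.
  by case=> u v [/= -> ->].
have [uvc|uvc] := pselect ((u * v)%g = c).
- have : nbhs (u, v) [set p | (p.1 * p.2)%g = c].
    by apply: (@mulg_continuous S (u, v) [set c]); apply: open_nbhs_nbhs; split.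
  case=> -[U V] [/= nU nV] UV; exists (U `*` V); first by exists (U, V).
  apply: (@sub_finite_set _ _ (f @` [set n | U (x n) /\ V (y n)])).
    move=> _ [[n _ <-] [_ [->] [/= Ux Vy]]]; by exists n.
  apply: finite_image; have [[m [Um _]]|none] :=
    pselect (exists m, U (x m) /\ V (y m)).
    (* The crossed pair [(x m, y n)] lies in [U `*` V]. *)
    apply: (sub_finite_set _ (finite_set1 m)) => n [_ Vn] /=.
    by symmetry; apply/xyc; apply: (UV (x m, y n)).
  by apply: (sub_finite_set _ (finite_set0 _)) => n Un; apply: none; exists n.
- exists [set p | (p.1 * p.2)%g <> c].
    apply: (@mulg_continuous S (u, v) (~` [set c])); apply: open_nbhs_nbhs; split=> //.
    by rewrite openC; exact: accessible_closed_set1.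
  apply: (sub_finite_set _ (finite_set0 _)).
  by move=> _ [[n _ <-] [_ [->]]] /=; apply; apply/xyc.
Qed.

Section Translations.
Import GRing.Theory.
Local Open Scope ring_scope.

Lemma translation_pdom (k : int) : cofinite_set (pdom (fun z => Some (z + k))).
Proof.
apply: (sub_finite_set _ (finite_set0 _)) => z /=.
by apply; exists (z + k).
Qed.

Lemma translation_pran (k : int) : cofinite_set (pran (fun z => Some (z + k))).
Proof.
apply: (sub_finite_set _ (finite_set0 _)) => z /=.
by apply; exists (z - k); rewrite subrK.
Qed.

Lemma translation_isometry (k : int) : pisometry (fun z => Some (z + k)).
Proof. by move=> z w _ _ [<-] [<-]; rewrite opprD addrACA subrr addr0. Qed.

Definition translation (k : int) : ID_infty :=
  MkID (translation_pdom k) (translation_pran k) (translation_isometry k).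

Lemma translation_inj : injective translation.
Proof. by move=> k l /(congr1 (fun a : ID_infty => a 0)) [] /addrI. Qed.

Lemma translationD (k l : int) :
  (translation k * translation l)%g = translation (k + l).
Proof. by apply: ID_eq => z; rewrite /= /pcomp /= addrA. Qed.

Lemma translationB_eq0 (m n : nat) :
  (translation m%:Z * translation (- n%:Z))%g = translation 0 <-> m = n.
Proof.
rewrite translationD; split=> [/translation_inj/eqP|->]; last by rewrite subrr.
by rewrite subr_eq0 => /eqP[].
Qed.

End Translations.

Theorem mainTheorem6 (S : topologicalSemigroupType)
    (iota : {multiplicative ID_infty -> S}) :
  hausdorff_space S ->
  injective iota ->
  dense (range iota) ->
  discrete_subspace (range iota) ->
  ~ feebly_compact (S * S)%type.
Proof.
move=> /hausdorff_accessible T1 iotaI dI discI.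
have oiota a : open [set iota a].
  by apply: dense_discrete_open1 dI discI _ => //; exists a.
apply: (@crossed_factorizations_not_feebly_compact _ (iota (translation 0%R))
  (fun n => iota (translation n%:Z%R))
  (fun n => iota (translation (- n%:Z)%R))) => // m n.
by rewrite -gmulfM; split=> [/iotaI/translationB_eq0|/translationB_eq0 ->].
Qed.
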